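(* Let $G$ be a countable group and let $N$ be a subgroup of $G$ of finite index in $G$. If $N$ is framenable, then $G$ is framenable.
   Context: ''Countable'' means countably infinite; groups are discrete. Hilbert spaces are complex and separable; $\mathcal U(H)$ is the group of unitary operators on $H$. A countable discrete group $G$ is framenable if there exist a unitary representation $\pi:G\to\mathcal U(H)$ with $1_G\prec\pi$, a countable (infinite) subset $S\subset G$, and a vector $v\in H$ such that $\{\pi_g v\}_{g\in S}$ is a weak frame. Here $1_G\prec\pi$ means that there is a net $(v_i)_{i\in I}$ of unit vectors in $H$ with $\|\pi_g v_i-v_i\|\to0$ for every $g\in G$. A family $\{f_n\}_{n\in S}$ in $H$ indexed by a countable set $S$ is a weak frame if $0<\sum_{n\in S}|\langle v,f_n\rangle|^2<\infty$ for every $v\in H$, $v\ne0$ (equivalently, it has dense linear span and there is $B>0$ with $\sum_{n\in S}|\langle v,f_n\rangle|^2\le B\|v\|^2$ for all $v\in H$). *)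

(* Defs.v *)
From mathcomp Require Import all_boot all_order all_algebra sesquilinear.
From mathcomp Require Import all_classical all_reals all_analysis.
From mathcomp Require Import complex.

Set Implicit Arguments.
Unset Strict Implicit.
Unset Printing Implicit Defensive.

Import Order.TTheory GRing.Theory Num.Theory.
Import numFieldNormedType.Exports.

Local Open Scope ring_scope.
Local Open Scope classical_set_scope.
Local Open Scope complex_scope.

(* Separable complex Hilbert spaces. The inner product is linear in its first
   argument and conjugate-linear in the second. *)
Record hilbert (R : realType) := Hilbert {
  hilbert_sort :> completeNormedModType R[i];
  inner : {dot hilbert_sort for Num.conj};
  hilbert_norm : forall x : hilbert_sort, `|x| ^+ 2 = inner x x;
  hilbert_separable : exists2 D : set hilbert_sort, countable D & dense D }.

Definition unitary (R : realType) (H : hilbert R) (u : {linear H -> H}) : Prop :=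
  (forall x y : H, inner H (u x) (u y) = inner H x y) /\
  (forall y : H, exists x : H, u x = y).

Record unitary_rep (R : realType) (G : groupType) (H : hilbert R) := UnitaryRep {
  rep :> G -> {linear H -> H};
  rep_unitary : forall g : G, unitary (rep g);
  repM : forall (g h : G) (x : H), rep (g * h)%g x = rep g (rep h x) }.

Record directed (I : Type) (le : I -> I -> Prop) : Prop := Directed {
  directed_nonempty : inhabited I;
  directed_refl : forall i, le i i;
  directed_trans : forall i j k, le i j -> le j k -> le i k;
  directed_ub : forall i j, exists k, le i k /\ le j k }.

(* Convergence of a net is convergence along the filter of its tails. *)
Definition tails (I : Type) (le : I -> I -> Prop) : set_system I :=
  filter_from [set: I] (fun i => [set j | le i j]).

(* The norm of a vector is an element of R[i], whose topology is only found
   through its numFieldType structure, hence the cast of the limit. *)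
Definition weakly_contains_trivial (R : realType) (G : groupType)
    (H : hilbert R) (pi : unitary_rep G H) : Prop :=
  exists (I : Type) (le : I -> I -> Prop) (v : I -> H),
    [/\ directed le,
        (forall i, `|v i| = 1) &
        (forall g : G, `|pi g (v i) - v i| @[i --> tails le] --> (0 : (R[i] : numFieldType)))].

(* normc is the R-valued modulus on R[i]. *)
Definition weak_frame (R : realType) (H : hilbert R) (I : choiceType)
    (S : set I) (f : I -> H) : Prop :=
  forall v : H, v != 0 ->
    (0 < \esum_(i in S) (ComplexField.Normc.normc (inner H v (f i)) ^+ 2)%:E
       < +oo)%E.

Definition framenable (R : realType) (G : groupType) : Prop :=
  exists (H : hilbert R) (pi : unitary_rep G H),
    weakly_contains_trivial pi /\
    exists (S : set G) (v : H),
      (S #= [set: nat])%card /\ weak_frame S (fun g => pi g v).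

Definition finite_index (G : groupType) (N : {pred G}) : Prop :=
  finite_set [set [set (g * n)%g | n in [set` N]] | g in [set: G]].

(* Main.v *)
Require Import Defs.
From HB Require Import structures.
From mathcomp Require Import all_boot all_order all_algebra sesquilinear.
From mathcomp Require Import all_classical all_reals all_analysis.
From mathcomp Require Import complex.

(** Let a unitary representation [pi] of [N] on [H] be given, weakly containing
    the trivial one, with a weak frame [pi n v], [n] in [S]. The idea is that
    the representation of [G] induced from [pi] does the same job for [G].

    Write [G] as the disjoint union of finitely many cosets [t i N]. The induced
    representation lives on the direct sum of copies of [H], one per coset, with
    the l2 norm: an element [g] permutes the cosets, and on the way from the
    coset of [t k] to that of [t j] it acts by [pi] at the element
    [(t j)^-1 g (t k)] of [N] ([induced_rep]).

    Weak containment survives ([induced_weakly_contains_trivial]): if the unit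
    vectors [v j] are almost invariant under [pi], the constant families
    [v j / sqrt |G : N|] are unit vectors, and the displacement of such a family
    under [g] is controlled by the displacements of [v j] under the finitely
    many elements of [N] that [g] involves.

    The weak frame survives as well ([induced_weak_frame]). Put [v] in a single
    coordinate [i0]. The element [t i n (t i0)^-1] moves it to coordinate [i],
    where it becomes [pi n v] ([induced_spike]). Hence the coefficients of a
    family [f] against the translates by [t i n (t i0)^-1], for all [i] and all
    [n] in [S], are the coefficients of all the [f i] against the frame of [H]:
    the sum of their squares is a finite sum of finite terms, one of which at
    least is positive when [f] is nonzero. *)

Set Implicit Arguments.
Unset Strict Implicit.
Unset Printing Implicit Defensive.

Import Order.TTheory GRing.Theory Num.Theory.
Import numFieldNormedType.Exports.

Local Open Scope ring_scope.
Local Open Scope classical_set_scope.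
Local Open Scope complex_scope.

(** * The l2 norm of a finite family of nonnegative numbers *)

Section minkowski.
Variables (C : numClosedFieldType) (I : finType).

Definition l2 (x : I -> C) : C := sqrtC (\sum_i x i ^+ 2).

Lemma l2_ge0 (x : I -> C) : (forall i, 0 <= x i) -> 0 <= l2 x.
Proof. by move=> x0; rewrite sqrtC_ge0 sumr_ge0// => i _; rewrite exprn_ge0. Qed.

Lemma l2_ge_coord (x : I -> C) i : (forall i, 0 <= x i) -> x i <= l2 x.
Proof.
move=> x0; rewrite -ler_sqr ?nnegrE ?l2_ge0// sqrtCK (bigD1 i)//=.
by rewrite lerDl sumr_ge0// => j _; rewrite exprn_ge0.
Qed.

Lemma le_l2 (x y : I -> C) : (forall i, 0 <= x i) -> (forall i, x i <= y i) ->
  l2 x <= l2 y.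
Proof.
move=> x0 xy; rewrite ler_sqrtC ?nnegrE ?sumr_ge0//.
- by apply: ler_sum => i _; rewrite lerXn2r ?nnegrE ?x0 ?(le_trans _ (xy i)).
- by move=> i _; rewrite exprn_ge0.
- by move=> i _; rewrite exprn_ge0// (le_trans _ (xy i)).
Qed.

Lemma l2_le_sum (x : I -> C) : (forall i, 0 <= x i) -> l2 x <= \sum_i x i.
Proof.
move=> x0; have s0 : 0 <= \sum_i x i by rewrite sumr_ge0.
rewrite -ler_sqr ?nnegrE ?l2_ge0// sqrtCK expr2 mulr_suml ler_sum// => i _.
by rewrite expr2 ler_wpM2l// (bigD1 i)//= lerDl sumr_ge0.
Qed.

Lemma l2_eq0 (x : I -> C) : (forall i, 0 <= x i) -> l2 x = 0 -> forall i, x i = 0.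
Proof.
by move=> x0 l0 i; apply/le_anti; rewrite x0 andbT -l0 l2_ge_coord.
Qed.

(** With [a] and [b] the two norms, expanding squares reduces the inequality to
    the sum over [i] of [2 a b x_i y_i <= (b x_i)^2 + (a y_i)^2], whose right-hand
    sides add up to [2 a^2 b^2]. *)
Lemma minkowski_l2 (x y : I -> C) : (forall i, 0 <= x i) -> (forall i, 0 <= y i) ->
  l2 (fun i => x i + y i) <= l2 x + l2 y.
Proof.
move=> x0 y0; set a := l2 x; set b := l2 y.
have a0 : 0 <= a by exact: l2_ge0.
have b0 : 0 <= b by exact: l2_ge0.
have [az|an0] := eqVneq a 0.
  rewrite az add0r /b (_ : (fun i => _) = y)//; apply/funext => i.
  by rewrite (l2_eq0 x0 az) add0r.
have [bz|bn0] := eqVneq b 0.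
  rewrite bz addr0 /a (_ : (fun i => _) = x)//; apply/funext => i.
  by rewrite (l2_eq0 y0 bz) addr0.
have ap : 0 < a by rewrite lt_def an0.
have bp : 0 < b by rewrite lt_def bn0.
have xa : \sum_i x i ^+ 2 = a ^+ 2 by rewrite sqrtCK.
have yb : \sum_i y i ^+ 2 = b ^+ 2 by rewrite sqrtCK.
rewrite -ler_sqr ?nnegrE ?addr_ge0//; last by rewrite l2_ge0// => i; rewrite addr_ge0.
rewrite sqrtCK sqrrD -xa -yb.
under eq_bigr do rewrite sqrrD.
rewrite 2!big_split/= lerD2r lerD2l.
suff : a * b * \sum_i (x i * y i *+ 2) <= a * b * (a * b *+ 2).
  by rewrite ler_pM2l ?mulr_gt0.
rewrite (_ : a * b * (a * b *+ 2) = b ^+ 2 * a ^+ 2 + a ^+ 2 * b ^+ 2); last first.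
  by rewrite mulrnAr -expr2 exprMn mulr2n [b ^+ 2 * _]mulrC.
rewrite -{1}xa -{2}yb !mulr_sumr -big_split/= ler_sum// => i _.
rewrite -!exprMn.
have -> : a * b * (x i * y i *+ 2) = (b * x i) * (a * y i) *+ 2.
  by rewrite mulrnAr [a * b]mulrC mulrACA.
rewrite -subr_ge0 addrAC -sqrrB real_exprn_even_ge0//.
by rewrite rpredB// ger0_real// mulr_ge0// ltW.
Qed.
End minkowski.

(** * The finite l2 direct sum of copies of a Hilbert space *)

Section l2sum.
Variables (R : realType) (H : hilbert R) (I : finType).

(** A separate name keeps the l2 norm apart from any other topology or norm on
    finite functions. *)
Definition l2sum : Type := {ffun I -> H}.

HB.instance Definition _ := GRing.Lmodule.copy l2sum {ffun I -> H}.

Definition l2norm (f : l2sum) : R[i] := l2 (fun i => `|f i|).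

Lemma l2normD (f g : l2sum) : l2norm (f + g) <= l2norm f + l2norm g.
Proof.
apply: le_trans (minkowski_l2 _ _) => //.
by apply: le_l2 => // i; rewrite ffunE ler_normD.
Qed.

Lemma l2normZ (a : R[i]) (f : l2sum) : l2norm (a *: f) = `|a| * l2norm f.
Proof.
rewrite /l2norm /l2 -(sqrCK (normr_ge0 a)) -sqrtCM ?nnegrE ?exprn_ge0//.
  by congr sqrtC; rewrite mulr_sumr; apply: eq_bigr => i _; rewrite ffunE normrZ exprMn.
by rewrite sumr_ge0// => i _; rewrite exprn_ge0.
Qed.

Lemma l2norm_eq0 (f : l2sum) : l2norm f = 0 -> f = 0.
Proof.
move=> f0; apply/ffunP => i; rewrite ffunE; apply/normr0_eq0.
by apply: (l2_eq0 _ f0).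
Qed.

HB.instance Definition _ :=
  Lmodule_isNormed.Build R[i] l2sum l2normD l2normZ l2norm_eq0.

(** Together with [norm_le_sum] this squeezes the l2 norm between the norms of
    the coordinates and their sum, so that convergence, Cauchy filters and
    density can all be treated one coordinate at a time. *)
Lemma norm_coord_le (f : l2sum) i : `|f i| <= `|f|.
Proof. exact: (@l2_ge_coord _ _ (fun i => `|f i|)). Qed.

Lemma norm_le_sum (f : l2sum) : `|f| <= \sum_i `|f i|.
Proof. exact: l2_le_sum. Qed.

Lemma coordB (f g : l2sum) i : (f - g) i = f i - g i.
Proof. by rewrite !ffunE. Qed.

End l2sum.

(** The denominator is [#|I|.+1] rather than [#|I|], which gives a strict
    inequality and covers an empty index type. *)
Lemma sum_fraction_lt (F : numFieldType) (I : finType) (e : F) : 0 < e ->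
  \sum_(i : I) e / #|I|.+1%:R < e.
Proof.
move=> e0; rewrite sumr_const -[ltLHS]mulr_natl mulrCA gtr_pMr//.
by rewrite ltr_pdivrMr// mul1r ltr_nat.
Qed.

Section l2sum_hilbert.
Variables (R : realType) (H : hilbert R) (I : finType).
Local Notation L := (l2sum H I).

(** A Cauchy filter converges coordinatewise by completeness of [H], and the sum
    of the coordinate distances bounds the l2 distance. *)
Lemma l2sum_complete (F : set_system L) : ProperFilter F -> cauchy F -> cvg F.
Proof.
move=> FF /cauchy_ballP Fc.
have Fi i : cvg ((fun f : L => f i) @ F).
  apply: cauchy_cvg; apply/cauchy_ballP => e e0; near_simpl.
  rewrite near_map2.
  apply: (@filterS _ (filter_prod F F) _ _ _ _ (Fc e e0)) => -[f g]/=.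
  rewrite -!ball_normE/=; apply: le_lt_trans.
  by rewrite -coordB; exact: norm_coord_le.
pose l : L := [ffun i => lim ((fun f : L => f i) @ F)].
apply/cvg_ex; exists l; apply/cvgrPdist_lt => e e0.
have e'0 : 0 < e / #|I|.+1%:R by rewrite divr_gt0.
near=> f; rewrite (le_lt_trans (norm_le_sum _))//.
apply: (@le_lt_trans _ _ (\sum_(i : I) e / #|I|.+1%:R)).
  apply: ler_sum => i _; rewrite coordB ltW//.
  suff : forall i, `|l i - f i| < e / #|I|.+1%:R by [].
  near: f; apply: filter_forall => {}i; rewrite ffunE.
  by have /cvgrPdist_lt := Fi i; exact.
exact: sum_fraction_lt.
Unshelve. all: by end_near. Qed.

HB.instance Definition _ := Uniform_isComplete.Build L l2sum_complete.

Definition l2inner (f g : L) : R[i] := \sum_i inner H (f i) (g i).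

Lemma l2inner_bilinear :
  bilinear_for ( *%R : GRing.Scale.law _ _)
    (Num.conj \; *%R : GRing.Scale.law _ _) l2inner.
Proof.
split=> [g a f1 f2|f a g1 g2]; rewrite /l2inner /= mulr_sumr -big_split/=.
  by apply: eq_bigr => i _; rewrite !ffunE linearPl.
by apply: eq_bigr => i _; rewrite !ffunE linearPr.
Qed.

HB.instance Definition _ := bilinear_isBilinear.Build R[i] L L R[i] *%R
  (Num.conj \; *%R) l2inner l2inner_bilinear.

Lemma l2inner_hermitian (f g : L) :
  l2inner f g = (-1) ^+ false * Num.conj (l2inner g f).
Proof.
rewrite mul1r raddf_sum; apply: eq_bigr => i _.
by rewrite hermC mul1r.
Qed.

HB.instance Definition _ := isHermitianSesquilinear.Build R[i] L false Num.conj
  l2inner l2inner_hermitian.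

Lemma l2inner_norm (f : L) : `|f| ^+ 2 = l2inner f f.
Proof.
by rewrite [LHS]sqrtCK; apply: eq_bigr => i _; rewrite hilbert_norm.
Qed.

Lemma l2inner_gt0 (f : L) : f != 0 -> 0 < l2inner f f.
Proof. by move=> f0; rewrite -l2inner_norm exprn_gt0// normr_gt0. Qed.

HB.instance Definition _ := isDotProduct.Build R[i] L l2inner l2inner_gt0.

(** The families with all coordinates in a countable dense subset of [H] are
    dense, and they are parametrized by the countable type of finite functions
    from [I] to [nat]. *)
Lemma l2sum_separable : exists2 D : set L, countable D & dense D.
Proof.
have [D cD dD] := hilbert_separable H.
have [x Dx] : exists x, D x.
  have [x [_ Dx]] : [set: H] `&` D !=set0 by apply: dD; [exists 0|exact: openT].
  by exists x.
have [e eD] : exists e : nat -> H, D `<=` range e.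
  have [D0|[f]] := pfcard_geP cD; first by rewrite D0 in Dx.
  by exists f; exact: surj.
exists (range (fun a : {ffun I -> nat} => [ffun i => e (a i)] : L)).
  exact: sub_countable (card_image_le _ _) (countableP _).
move=> O [f Of] oO.
have := open_nbhs_nbhs (conj oO Of).
rewrite -nbhs_ballE => -[r r0 rO].
have r'0 : 0 < r / #|I|.+1%:R by rewrite divr_gt0.
have /choice[a ha] : forall i, exists n, `|f i - e n| < r / #|I|.+1%:R.
  move=> i; have [||y [/= fy /eD[n _ ny]]] := dD (ball (f i) (r / #|I|.+1%:R)).
  - by exists (f i); exact: ballxx.
  - exact: ball_open.
  - by exists n; rewrite ny; move: fy; rewrite -ball_normE.
exists [ffun i => e ([ffun i => a i] i)]; split; last by exists [ffun i => a i].
apply: rO; rewrite -ball_normE /=.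
rewrite (le_lt_trans (norm_le_sum _))//.
apply: (@le_lt_trans _ _ (\sum_(i : I) r / #|I|.+1%:R)).
  by apply: ler_sum => i _; rewrite coordB !ffunE ltW.
exact: sum_fraction_lt.
Qed.

Definition l2hilbert : hilbert R :=
  @Hilbert R L l2inner l2inner_norm l2sum_separable.

End l2sum_hilbert.

(** * Subgroups of finite index *)

Section subgroup.
Variables (G : groupType) (P : {pred G}) (N : subGroupType P).

(** The value outside [P] is arbitrary: it is the unit. *)
Definition toSub (g : G) : N := insubd 1%g g.

Lemma val_toSub (g : G) : g \in P -> val (toSub g) = g.
Proof. by move=> gP; rewrite insubdK. Qed.

Lemma toSub_val (n : N) : toSub (val n) = n.
Proof. exact: valKd. Qed.

Lemma subgroup_mul (g h : G) : g \in P -> h \in P -> (g * h)%g \in P.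
Proof.
by move=> gP hP; rewrite -(val_toSub gP) -(val_toSub hP) -valM; exact: valP.
Qed.

Lemma subgroup_inv (g : G) : g \in P -> (g^-1)%g \in P.
Proof.
move=> gP; suff -> : (g^-1)%g = val (toSub g)^-1%g by exact: valP.
by rewrite gmulfV; congr (_^-1)%g; rewrite [RHS]val_toSub.
Qed.

Lemma subgroup_one : (1%g : G) \in P.
Proof. by rewrite -(val1 N); exact: valP. Qed.

Lemma toSubM (g h : G) : g \in P -> h \in P ->
  toSub (g * h)%g = (toSub g * toSub h)%g.
Proof.
by move=> gP hP; apply: val_inj; rewrite valM !val_toSub// subgroup_mul.
Qed.

(** The left cosets are numbered by ['I_d]: [c] sends an element to the number
    of its coset and [t] chooses a representative of each coset. *)
Lemma finite_index_transversal : finite_index P ->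
  exists (d : nat) (c : G -> 'I_d) (t : 'I_d -> G),
    (forall i, c (t i) = i) /\
    (forall g h, c g = c h <-> (g^-1 * h)%g \in P).
Proof.
move=> /finite_setP[d /pcard_eqP[f]].
pose coset (g : G) := [set (g * n)%g | n in [set` P]].
have cosetP g : [set coset g | g in [set: G]] (coset g) by exists g.
pose c (g : G) : 'I_d := Ordinal (@funS _ _ _ _ f _ (cosetP g)).
have cK g h : c g = c h <-> (g^-1 * h)%g \in P.
  split=> [/(congr1 val)/= fgh|ghP].
  - have : coset g = coset h.
      by apply: ('inj_f) fgh; rewrite inE; exact: cosetP.
    move=> /seteqP[_ /(_ h)] []; first by exists 1%g; rewrite ?mulg1//; exact: subgroup_one.
    by move=> n nP <-; rewrite mulKg.
  - apply/val_inj => /=; congr (f _); apply/seteqP; split=> x [n nP <-].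
    + exists ((g^-1 * h)^-1 * n)%g.
        by apply: subgroup_mul => //; exact: subgroup_inv.
      by rewrite invgM invgK !mulgA mulgV mul1g.
    + exists ((g^-1 * h) * n)%g; first exact: subgroup_mul.
      by rewrite !mulgA mulgV mul1g.
have /choice[t ct] : forall i, exists g, c g = i.
  move=> i; have [_ [g _ <-] fgi] := 'surj_f (ltn_ord i).
  by exists g; exact: val_inj.
by exists d, c, t.
Qed.

End subgroup.

(** By multiplicativity the operator at [1] is idempotent; being onto, it is the
    identity. *)
Lemma rep1 (R : realType) (G : groupType) (H : hilbert R)
  (pi : unitary_rep G H) (x : H) : pi 1%g x = x.
Proof.
by have [_ /(_ x)[y <-]] := rep_unitary pi 1%g; rewrite -repM mulg1.
Qed.

(** * The induced representation *)

Section induced.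
Variables (R : realType) (G : groupType) (P : {pred G}) (N : subGroupType P).
Variables (H : hilbert R) (pi : unitary_rep N H).
Variables (I : finType) (c : G -> I) (t : I -> G).
Hypothesis ct : forall i, c (t i) = i.
Hypothesis cP : forall g h, c g = c h <-> (g^-1 * h)%g \in P.

Lemma class_mul g h k : c h = c k -> c (g * h)%g = c (g * k)%g.
Proof. by move=> /cP hk; apply/cP; rewrite invgM -mulgA mulKg. Qed.

(** The index of the coset [g^-1 (t j) N], which [g] sends to [t j N]. *)
Definition pull (g : G) (j : I) : I := c (g^-1 * t j)%g.

Definition cocycle (g : G) (j : I) : G := ((t j)^-1 * g * t (pull g j))%g.

Lemma cocycle_in g j : cocycle g j \in P.
Proof.
have /cP : c (g^-1 * t j)%g = c (t (pull g j)) by rewrite ct.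
by rewrite invgM invgK.
Qed.

(** Left translation by [G] permutes the cosets; the order of composition is
    reversed because [pull] uses inverses. *)
Lemma pullM g h j : pull (g * h)%g j = pull h (pull g j).
Proof. by rewrite /pull invgM -mulgA; apply: class_mul; rewrite ct. Qed.

Lemma pull1 j : pull 1%g j = j.
Proof. by rewrite /pull invg1 mul1g ct. Qed.

Lemma pull_bij g : bijective (pull g).
Proof.
by exists (pull g^-1%g) => j; rewrite -pullM ?mulgV ?mulVg pull1.
Qed.

(** The cocycle identity, which is what makes the induced operators
    multiplicative: the two inner representatives cancel. *)
Lemma cocycleM g h j :
  cocycle (g * h)%g j = (cocycle g j * cocycle h (pull g j))%g.
Proof. by rewrite /cocycle pullM !mulgA mulgK. Qed.

Definition induced_fun (g : G) (f : l2hilbert H I) : l2hilbert H I :=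
  [ffun j => pi (toSub N (cocycle g j)) ((f : l2sum H I) (pull g j))].

Lemma induced_fun_linear g : linear (induced_fun g).
Proof. by move=> a f h; apply/ffunP => j; rewrite !ffunE linearP. Qed.

HB.instance Definition _ g := GRing.isLinear.Build R[i] (l2hilbert H I)
  (l2hilbert H I) _ (induced_fun g) (induced_fun_linear g).

Definition induced (g : G) : {linear l2hilbert H I -> l2hilbert H I} :=
  induced_fun g.

Lemma inducedM g h f : induced (g * h)%g f = induced g (induced h f).
Proof.
apply/ffunP => j; rewrite !ffunE -repM -toSubM; [|exact: cocycle_in..].
by rewrite cocycleM pullM.
Qed.

Lemma induced1 f : induced 1%g f = f.
Proof.
apply/ffunP => j; rewrite !ffunE pull1 /cocycle mulg1 pull1 mulVg.
by rewrite -(val1 N) toSub_val rep1.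
Qed.

(** Each [induced g] permutes the coordinates and applies a unitary operator in
    each of them, so it preserves inner products; it is onto because
    [induced g^-1] is a right inverse. *)
Lemma induced_unitary g : unitary (induced g).
Proof.
split=> [x y|y]; last first.
  by exists (induced g^-1%g y); rewrite -inducedM mulgV induced1.
rewrite /= /l2inner [RHS](reindex (pull g))/=; last exact/onW_bij/pull_bij.
apply: eq_bigr => j _; rewrite !ffunE.
by have [+ _] := rep_unitary pi (toSub N (cocycle g j)); exact.
Qed.

Definition induced_rep : unitary_rep G (l2hilbert H I) :=
  UnitaryRep induced_unitary inducedM.

End induced.

(** * Weak containment and weak frames under induction *)

Lemma tails_filter (J : Type) (le : J -> J -> Prop) :
  directed le -> Filter (tails le).
Proof.
move=> dle; apply: filter_from_filter.
  by have [[j]] := dle; exists j.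
move=> i j _ _; have [k [ik jk]] := directed_ub dle i j.
exists k => // l /= kl; split; exact: directed_trans dle _ _ _ _ kl.
Qed.

Section induced_framenable.
Variables (R : realType) (G : groupType) (P : {pred G}) (N : subGroupType P).
Variables (H : hilbert R) (pi : unitary_rep N H).
Variables (I : finType) (c : G -> I) (t : I -> G).
Hypothesis ct : forall i, c (t i) = i.
Hypothesis cP : forall g h, c g = c h <-> (g^-1 * h)%g \in P.
Variable i0 : I.

(** The constant family built on [v j] has norm [sqrt #|I|] times that of [v j],
    hence the factor [a]. Its displacement under [g] is at most the sum over the
    coordinates [k] of [a] times the displacement of [v j] under
    [cocycle c t g k], and finitely many limits can be taken at once. *)
Lemma induced_weakly_contains_trivial :
  weakly_contains_trivial pi -> weakly_contains_trivial (induced_rep pi ct cP).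
Proof.
move=> [J [le [v [dle v1 vcvg]]]].
pose a : R[i] := (sqrtC #|I|%:R)^-1.
have I0 : (0 < #|I|)%N by apply/card_gt0P; exists i0.
have a0 : 0 < a by rewrite invr_gt0 sqrtC_gt0 ltr0n.
exists J, le, (fun j => [ffun=> a *: v j] : l2sum H I); split => //.
  move=> j; apply/eqP; rewrite -(@eqrXn2 _ 2)//; apply/eqP.
  rewrite expr1n [LHS]sqrtCK.
  under eq_bigr do rewrite ffunE normrZ v1 mulr1 gtr0_norm//.
  by rewrite sumr_const -mulr_natl exprVn sqrtCK divff// pnatr_eq0 -lt0n.
move=> g; have FF := tails_filter dle.
apply/cvgrPdist_lt => e e0.
have e'0 : 0 < a^-1 * (e / #|I|.+1%:R) by apply: mulr_gt0; [rewrite invr_gt0|rewrite divr_gt0].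
near=> j; rewrite sub0r normrN normr_id.
rewrite (le_lt_trans (norm_le_sum _))//.
apply: le_lt_trans (sum_fraction_lt I e0).
apply: ler_sum => k _; rewrite coordB !ffunE linearZ/= -scalerBr normrZ gtr0_norm//.
rewrite -ler_pdivlMl// ltW//.
move: k; near: j; apply: filter_forall => k.
have /cvgrPdist_lt/(_ _ e'0) := vcvg (toSub N (cocycle c t g k)).
by apply: filterS => j; rewrite sub0r normrN normr_id.
Unshelve. all: by end_near. Qed.

Variables (S : set N) (v : H).

Definition spike : l2hilbert H I :=
  [ffun i => if i == i0 then v else 0] : l2sum H I.

Definition translate (p : I * N) : G := (t p.1 * val p.2 * (t i0)^-1)%g.

(** The coset of [translate (i, n) * t i0] determines [i], and then [n] follows by
    cancellation. *)
Lemma translate_inj : injective translate.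
Proof.
move=> [i m] [j n]; rewrite /translate/= => /mulIg e.
have ij : i = j.
  rewrite -(ct i) -(ct j) (_ : c (t i) = c (t i * val m)%g).
    rewrite e; apply/cP; rewrite invgM -mulgA mulVg mulg1.
    exact: (subgroup_inv N (valP n)).
  by apply/cP; rewrite mulKg; exact: valP.
by move: e; rewrite ij => /mulgI/val_inj ->.
Qed.

(** The element [t i n (t i0)^-1] maps the coset of [t i0] to that of [t i], and
    the corresponding value of the cocycle is exactly [n]. Since [pull] is
    injective, no other coordinate sees [v]. *)
Lemma induced_spike i n :
  induced_rep pi ct cP (translate (i, n)) spike =
  ([ffun j => if j == i then pi n v else 0] : l2sum H I).
Proof.
have pulli : pull c t (translate (i, n)) i = i0.
  rewrite /pull /translate/= -[RHS]ct; apply/cP.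
  rewrite invgM invgK -!mulgA mulVg mulg1 mulKg.
  exact: valP.
apply/ffunP => j; rewrite !ffunE -{1}pulli (inj_eq (bij_inj (pull_bij ct cP _))).
case: eqP => [->|_]; last by rewrite linear0.
by rewrite /cocycle pulli /translate/= -!mulgA mulVg mulg1 mulKg toSub_val.
Qed.

Lemma inner_induced_spike (f : l2sum H I) i n :
  inner (l2hilbert H I) f (induced_rep pi ct cP (translate (i, n)) spike) =
  inner H (f i) (pi n v).
Proof.
rewrite induced_spike /= /l2inner (bigD1 i)//= ffunE eqxx big1 ?addr0//.
by move=> j /negPf ji; rewrite ffunE ji linear0r.
Qed.

(** The sum of the squared coefficients of [f] splits into the finitely many
    sums attached to its coordinates. Each of them is finite: by hypothesis
    when the coordinate is nonzero, trivially otherwise. A nonzero [f] has a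
    nonzero coordinate, whose sum is positive. *)
Lemma induced_weak_frame : weak_frame S (fun n => pi n v) ->
  weak_frame (translate @` ([set: I] `*` S))
    (fun g => induced_rep pi ct cP g spike).
Proof.
move=> Sv f f0.
rewrite esum_image; last by move=> p q _ _; exact: translate_inj.
pose a i n : \bar R :=
  (ComplexField.Normc.normc (inner H ((f : l2sum H I) i) (pi n v)) ^+ 2)%:E.
have a0 i n : (0 <= a i n)%E by rewrite lee_fin sqr_ge0.
rewrite (eq_esum (b := fun p => a p.1 p.2)); last first.
  by move=> [i n] _; rewrite inner_induced_spike.
rewrite -(@esum_esum _ _ _ [set: I] (fun=> S))//.
have finI : finite_set [set: I] := finite_finset.
rewrite esum_fset//; last by move=> i _; exact: esum_ge0.
rewrite fsbig_finite//=.
have Sge0 i : (0 <= \esum_(n in S) a i n)%E by exact: esum_ge0.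
have inner0E i : (f : l2sum H I) i = 0 -> \esum_(n in S) a i n = 0%E.
  move=> fi0; apply: esum1 => n _.
  by rewrite /a fi0 linear0l ComplexField.Normc.normc0 expr0n.
apply/andP; split.
  have [i fi0] : exists i, (f : l2sum H I) i != 0.
    apply/existsP; apply: contra_neqT f0 => /existsPn fi0.
    by apply/ffunP => i; rewrite ffunE; apply/eqP/negPn/fi0.
  have [Si _] := andP (Sv _ fi0).
  apply: lt_le_trans Si _.
  rewrite (bigD1_seq i)/=; [|by rewrite in_fset_set//; exact: mem_set|
                            exact: finmap.fset_uniq].
  by rewrite leeDl// sume_ge0.
apply: lte_sum_pinfty => i _.
have [/inner0E->//|fi0] := eqVneq ((f : l2sum H I) i) 0.
by have [] := andP (Sv _ fi0).
Qed.

End induced_framenable.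

Theorem theorem3p15 (R : realType) (G : groupType) (P : {pred G})
    (N : subGroupType P) (hG : ([set: G] #= [set: nat])%card)
    (hindex : finite_index P) (hN : framenable R N) :
  framenable R G.
Proof.
have [d [c [t [ct cP]]]] := finite_index_transversal N hindex.
have [H [pi [piw [S [v [Snat Sv]]]]]] := hN.
pose i0 := c 1%g.
exists (l2hilbert H 'I_d), (induced_rep pi ct cP); split.
  exact: induced_weakly_contains_trivial.
exists (translate t i0 @` ([set: 'I_d] `*` S)), (spike i0 v); split; last first.
  exact: induced_weak_frame.
apply/card_eqPle; split.
  (* at most countable, as a subset of the countable group *)
  by rewrite -(card_le_eqr hG) card_leT.
have /card_eqPle[_ natS] := Snat.
apply: (card_le_trans natS).
(* infinite, because the translates coming from the coordinate i0 alone are in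
   bijection with S *)
have Sinj : {in S &, injective (fun n => translate t i0 (i0, n))}.
  by move=> m n _ _ /(translate_inj ct cP)[].
rewrite -(card_le_eql (inj_card_eq Sinj)); apply: subset_card_le.
by move=> _ [n Sn <-]; exists (i0, n).
Qed.
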